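(* Suppose $k\ge3$. On a cuboid cell $T$ let $\boldsymbol Q_T$ be the space of vector fields $\boldsymbol q=(q_1,q_2,q_3)$ with $q_i\in\mathcal Q(i{:}k-2,j{:}k-1,l{:}k-1)$ for each $i$. The following degrees of freedom, taken for $i=1,2,3$, are unisolvent for $\boldsymbol Q_T$: (a) moments of $q_i$ on each edge $e_i$ of $T$ against $\mathcal Q(i{:}k-2)$; (b) for each $j\neq i$, moments of $q_i$ on each face $F_{ij}$ of $T$ against $\mathcal Q(i{:}k-2,j{:}k-3)$; (c) moments of $q_i$ on $T$ against $\mathcal Q(i{:}k-2,j{:}k-3,l{:}k-3)$.
   Context: Coordinates are $(x_1,x_2,x_3)=(x,y,z)$. Whenever indices $i,j,l$ occur together they are pairwise distinct, i.e. $\{i,j,l\}=\{1,2,3\}$. $\mathcal Q(i{:}a,j{:}b,l{:}c)$ is the space of polynomials of degree at most $a$ in $x_i$, at most $b$ in $x_j$ and at most $c$ in $x_l$ (separately); similarly with fewer variables on faces and edges. $T$ is an axis-parallel cuboid; $e_i$ denotes an edge parallel to the $x_i$-axis; $F_{ij}=F_{ji}$ denotes a face parallel to the $x_i$- and $x_j$-axes. ''Moments of $f$ on $G$ against $P$'' means the functionals $\int_G f\,p$, $p\in P$ (with $p$ running over a basis of $P$ when counting). Degrees of freedom are unisolvent for a shape function space if they form a basis of its dual space. *)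

(* Defs.v *)
From HB Require Import structures.
From mathcomp Require Import all_boot all_order all_algebra.
From mathcomp Require Import all_classical all_reals all_analysis.
(* The notations of mpoly clash with those of mathcomp-analysis. *)
From mathcomp Require Import -(notations) mpoly.

Set Implicit Arguments.
Unset Strict Implicit.
Unset Printing Implicit Defensive.

Import Order.TTheory GRing.Theory Num.Theory.
Local Open Scope classical_set_scope.
Local Open Scope ring_scope.

Definition ox : 'I_3 := @Ordinal 3 0 isT.
Definition oy : 'I_3 := @Ordinal 3 1 isT.
Definition oz : 'I_3 := @Ordinal 3 2 isT.

Section PolynomialSpaces.
Context (R : fieldType) (d : 'I_3 -> nat).

(* d m bounds the degree in x_m separately; a polynomial that does not depend
   on x_m is one with d m = 0. *)
Definition Qpred : {pred mpoly 3 R} :=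
  fun p => all (fun m : multinom 3 => [forall j, (m j <= d j)%N]) (msupp p).

Lemma QpredP (p : mpoly 3 R) :
  reflect (forall m : multinom 3, mcoeff m p != 0 -> forall j, (m j <= d j)%N)
          (p \in Qpred).
Proof.
apply: (iffP allP) => H m.
  by rewrite -mcoeff_msupp => /H /forallP.
by rewrite mcoeff_msupp => /H ?; apply/forallP.
Qed.

Lemma Qpred_submod_closed : submod_closed Qpred.
Proof.
split=> [|c p q /QpredP hp /QpredP hq]; apply/QpredP => m.
  by rewrite mcoeff0 eqxx.
rewrite mcoeffD mcoeffZ.
have [p0|/hp //] := eqVneq (mcoeff m p) 0.
by rewrite p0 mulr0 add0r => /hq.
Qed.

HB.instance Definition _ :=
  GRing.isSubmodClosed.Build R (mpoly 3 R) Qpred Qpred_submod_closed.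

Record Qpoly := QPoly { mpoly_of_Qpoly :> mpoly 3 R;
                        _ : mpoly_of_Qpoly \in Qpred }.

HB.instance Definition _ := [isSub for mpoly_of_Qpoly].
HB.instance Definition _ := [Choice of Qpoly by <:].
HB.instance Definition _ := [SubChoice_isSubLmodule of Qpoly by <:].

Definition Qmonomials : seq (multinom 3) :=
  [seq bmnm m | m <- enum [pred m : bmultinom 3 (\sum_j d j).+1 |
                            [forall j, (bmnm m j <= d j)%N]]].

Lemma Qmonomials_uniq : uniq Qmonomials.
Proof. by rewrite map_inj_uniq ?enum_uniq//; exact: val_inj. Qed.

Lemma mem_Qmonomials (m : multinom 3) :
  (m \in Qmonomials) = [forall j, (m j <= d j)%N].
Proof.
apply/mapP/idP => [[m' + ->]|hm]; first by rewrite mem_enum.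
have mlt : (mdeg m < (\sum_j d j).+1)%N.
  by rewrite ltnS mdegE leq_sum// => j _; exact: (forallP hm).
by exists (BMultinom mlt) => //; rewrite mem_enum.
Qed.

Lemma Qpoly_vecaxiom : vector_axiom (size Qmonomials) Qpoly.
Proof.
pose f (p : Qpoly) : 'rV[R]_(size Qmonomials) :=
  \row_i mcoeff (nth mnm0 Qmonomials i) (p : mpoly 3 R).
exists f; first by move=> c p q; apply/rowP => i; rewrite !mxE mcoeffD mcoeffZ.
pose g (r : 'rV[R]_(size Qmonomials)) : mpoly 3 R :=
  \sum_i r 0 i *: mpolyX R (nth mnm0 Qmonomials i).
have gE r m : mcoeff m (g r) =
    \sum_i r 0 i * (nth mnm0 Qmonomials i == m)%:R.
  by rewrite /g raddf_sum/=; apply: eq_bigr => i _; rewrite mcoeffZ mcoeffX.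
have gQ r : g r \in Qpred.
  apply/QpredP => m; rewrite gE => h; apply/forallP; rewrite -mem_Qmonomials.
  apply: contraNT h => /negP mN; rewrite big1// => i _.
  by case: eqP => [mE|]; rewrite ?mulr0//; case: mN; rewrite -mE mem_nth.
exists (fun r => QPoly (gQ r)).
  move=> p; apply/val_inj/mpolyP => m /=; rewrite gE.
  have [mQ|mNQ] := boolP (m \in Qmonomials).
    have mi : (index m Qmonomials < size Qmonomials)%N by rewrite index_mem.
    rewrite (bigD1 (Ordinal mi))//= mxE/= nth_index// eqxx mulr1 big1 ?addr0//.
    move=> i iN; case: eqP => [im|]; rewrite ?mulr0//.
    by case/eqP: iN; apply/val_inj; rewrite /= -im index_uniq// Qmonomials_uniq.
  rewrite big1 => [|i _]; last first.
    by case: eqP => [mE|]; rewrite ?mulr0//; case/negP: mNQ; rewrite -mE mem_nth.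
  apply/esym/eqP; apply: contraNT mNQ => h; rewrite mem_Qmonomials.
  by apply/forallP; exact: (QpredP _ (valP p)).
move=> r; apply/rowP => i; rewrite mxE/= gE (bigD1 i)//= eqxx mulr1 big1 ?addr0//.
by move=> j ji; rewrite nth_uniq ?Qmonomials_uniq// val_eqE (negPf ji) mulr0.
Qed.

HB.instance Definition _ :=
  Lmodule_hasFinDim.Build R Qpoly Qpoly_vecaxiom.

End PolynomialSpaces.

(* Elements of 'Hom(V, R^o) are determined by their values, so X is unique. *)
Definition unisolvent (R : fieldType) (V : vectType R)
    (dofs : seq (V -> R)) : Prop :=
  exists X : seq 'Hom(V, R^o),
    [seq (fun v => phi v : R) | phi : 'Hom(V, R^o) <- X] = dofs /\
    basis_of fullv X.

Definition shape_deg (k : nat) (i : 'I_3) : 'I_3 -> nat :=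
  fun m => if m == i then (k - 2)%N else (k - 1)%N.

Definition edge_deg (k : nat) (i : 'I_3) : 'I_3 -> nat :=
  fun m => if m == i then (k - 2)%N else 0%N.

Definition face_deg (k : nat) (i j : 'I_3) : 'I_3 -> nat :=
  fun m => if m == i then (k - 2)%N else if m == j then (k - 3)%N else 0%N.

Definition cell_deg (k : nat) (i : 'I_3) : 'I_3 -> nat :=
  fun m => if m == i then (k - 2)%N else (k - 3)%N.

Definition shape_space (R : fieldType) (k : nat) : vectType R :=
  (Qpoly R (shape_deg k ox) *
   Qpoly R (shape_deg k oy) *
   Qpoly R (shape_deg k oz))%type.

Definition component (R : fieldType) (k : nat) (q : shape_space R k)
    (i : 'I_3) : mpoly 3 R :=
  tnth [tuple q.1.1 : mpoly 3 R; q.1.2 : mpoly 3 R; q.2 : mpoly 3 R] i.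

Section Moments.
Context (R : realType) (a b : 'I_3 -> R).
Implicit Types (v : {ffun 'I_3 -> bool}) (i j m : 'I_3) (f p : mpoly 3 R).

Let mu := @lebesgue_measure R.

(* The vertices of the cuboid \prod_m [a m, b m] are coded by v.  The edge
   parallel to x_i through the vertex v is coded by its endpoint with
   x_i = a i, that is v i = false; the face parallel to x_i and x_j through v
   is coded by its vertex with x_i = a i and x_j = a j. *)
Definition vertex v : 'I_3 -> R := fun m => if v m then b m else a m.

Definition edge_point i v (s : R) : 'I_3 -> R :=
  fun m => if m == i then s else vertex v m.

Definition face_point i j v (st : R * R) : 'I_3 -> R :=
  fun m => if m == i then st.1 else if m == j then st.2 else vertex v m.

Definition cell_point (x : R * R * R) : 'I_3 -> R :=
  tnth [tuple x.1.1; x.1.2; x.2].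

Definition edge_moment i v p f : R :=
  \int[mu]_(s in `[a i, b i])
    (meval (edge_point i v s) f * meval (edge_point i v s) p).

Definition face_moment i j v p f : R :=
  \int[(mu \x mu)%E]_(st in `[a i, b i] `*` `[a j, b j])
    (meval (face_point i j v st) f * meval (face_point i j v st) p).

Definition cell_moment p f : R :=
  \int[(mu \x mu \x mu)%E]_(x in
      `[a ox, b ox] `*` `[a oy, b oy]
        `*` `[a oz, b oz])
    (meval (cell_point x) f * meval (cell_point x) p).

Definition edges i : seq {ffun 'I_3 -> bool} :=
  enum [pred v : {ffun 'I_3 -> bool} | ~~ v i].

Definition faces i j : seq {ffun 'I_3 -> bool} :=
  enum [pred v : {ffun 'I_3 -> bool} | ~~ v i & ~~ v j].

Definition edge_dofs k (E : forall i, {ffun 'I_3 -> bool} ->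
      seq (Qpoly R (edge_deg k i))) i : seq (shape_space R k -> R) :=
  [seq (fun q : shape_space R k => edge_moment i v p (component q i))
      | v : {ffun 'I_3 -> bool} <- edges i,
        p : Qpoly R (edge_deg k i) <- E i v].

Definition face_dofs k (F : forall i j, {ffun 'I_3 -> bool} ->
      seq (Qpoly R (face_deg k i j))) i : seq (shape_space R k -> R) :=
  flatten [seq [seq (fun q : shape_space R k =>
                       face_moment i j v p (component q i))
                   | v : {ffun 'I_3 -> bool} <- faces i j,
                     p : Qpoly R (face_deg k i j) <- F i j v]
              | j <- enum 'I_3 & j != i].

Definition cell_dofs k (C : forall i, seq (Qpoly R (cell_deg k i))) i :
    seq (shape_space R k -> R) :=
  [seq (fun q : shape_space R k => cell_moment p (component q i))
      | p : Qpoly R (cell_deg k i) <- C i].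

End Moments.

(* Main.v *)
(* Each moment of a monomial factors over the coordinates, so a component
   q_i = sum_m c_m x^m is tested by tensor products of one-variable functionals:
   along x_i the moments against 1, ..., t^(k-2), along any other axis the two
   endpoint evaluations and the moments against 1, ..., t^(k-3).  Two
   evaluations give an edge moment, one a face moment, none a cell moment.  In
   one variable both families are unisolvent: a polynomial orthogonal to all
   polynomials of its degree is orthogonal to itself, and one that vanishes at
   both endpoints is (t - a)(b - t) r, where the weight (t - a)(b - t) is
   nonnegative.  Eliminating one variable at a time gives q_i = 0.  For each i
   there are 4(k-1) + 4(k-1)(k-2) + (k-1)(k-2)^2 = (k-1)k^2 functionals, which
   is the dimension of the space of q_i. *)
Require Import Defs.
From HB Require Import structures.
From mathcomp Require Import all_boot all_order all_algebra.
From mathcomp Require Import all_classical all_reals all_analysis.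
From mathcomp Require Import measurable_realfun ring.
From mathcomp Require Import -(notations) mpoly.
Set Implicit Arguments.
Unset Strict Implicit.
Unset Printing Implicit Defensive.
Import Order.TTheory GRing.Theory Num.Theory.
Import numFieldNormedType.Exports.
Local Open Scope classical_set_scope.
Local Open Scope ring_scope.

(** * Linear algebra *)

(** Moments are linear only under measurability and integrability conditions, so linearity enters as
    a hypothesis and is packed into a structure inside the proof. *)
Lemma linfun_linearE (K : fieldType) (U V : vectType K) (f : U -> V) :
  linear f -> linfun f =1 f.
Proof.
move=> hf u; pose L : {linear U -> V} :=
  HB.pack f (GRing.isLinear.Build _ _ _ _ f hf).
exact: (lfunE L u).
Qed.

Lemma basis_of_dual (K : fieldType) (V : vectType K) (X : seq 'Hom(V, K^o)) :
  size X = \dim {:V} ->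
  (forall v, (forall phi, phi \in X -> phi v = 0) -> v = 0) ->
  basis_of fullv X.
Proof.
(* The joint evaluation map is injective between spaces of equal dimension,
   hence onto, and a preimage of a unit vector reads off one coefficient. *)
move=> sX kerX; pose n := size X; pose T := in_tuple X.
pose ev : V -> 'rV[K]_n := fun v => \row_j (T`_j v).
have evL : linear ev.
  by move=> c u v; apply/rowP => j; rewrite !mxE linearP.
have evE := linfun_linearE evL.
have ker0 : lker (linfun ev) == 0%VS.
  rewrite -subv0; apply/subvP => v; rewrite memv_ker evE memv0 => /eqP ev0.
  apply/eqP/kerX => phi /(nthP 0)[j jn <-].
  by have := congr1 (fun r : 'rV_n => r 0 (Ordinal jn)) ev0; rewrite !mxE.
have limF : limg (linfun ev) = fullv.
  apply/eqP; rewrite -(dimv_leqif_eq (subvf _)) limg_dim_eq.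
    by rewrite -sX dimvf /dim/= mul1n.
  by rewrite (eqP ker0) capv0.
have dimE : \dim {:'Hom(V, K^o)} = n by rewrite dimvf /dim/= muln1 -dimvf.
rewrite basisEfree subvf dimE leqnn !andbT.
suff: free T by [].
apply/freeP => c c0 j.
have /memv_imgP[v _ vE] : delta_mx 0 j \in limg (linfun ev).
  by rewrite limF memvf.
move: vE; rewrite evE => /rowP vE.
have := congr1 (fun phi : 'Hom(V, K^o) => phi v) c0.
rewrite lfunE/= sum_lfunE (bigD1 j)//= big1 => [|l lj].
  rewrite addr0 scale_lfunE; have := vE j; rewrite !mxE !eqxx => <-.
  by rewrite [_ *: _]mulr1.
rewrite scale_lfunE; have := vE l; rewrite !mxE (negPf lj) => <-.
by rewrite scaler0.
Qed.

(** * Polynomials in three variables *)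

Lemma big_ord3 (T : Type) (idx : T) (op : Monoid.law idx) (F : 'I_3 -> T) :
  \big[op/idx]_j F j = op (op (F ox) (F oy)) (F oz).
Proof.
rewrite !big_ord_recr big_ord0/= Monoid.mul1m.
by congr (op (op (F _) (F _)) (F _)); exact: val_inj.
Qed.

Lemma forall_ord3 (P : 'I_3 -> Prop) : P ox -> P oy -> P oz -> forall j, P j.
Proof.
move=> Px Py Pz [[|[|[|//]]] jlt].
- by rewrite (_ : Ordinal jlt = ox)//; exact: val_inj.
- by rewrite (_ : Ordinal jlt = oy)//; exact: val_inj.
- by rewrite (_ : Ordinal jlt = oz)//; exact: val_inj.
Qed.

Lemma ord3_cover (i j l m : 'I_3) : j != i -> l != i -> l != j ->
  m \in [:: i; j; l].
Proof.
by move: i j l m; do 4 elim/forall_ord3.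
Qed.

Definition mnm3 (x : nat * nat * nat) : multinom 3 :=
  Multinom [tuple x.1.1; x.1.2; x.2].

Lemma mnm3E (m : multinom 3) : m = mnm3 (m ox, m oy, m oz).
Proof.
apply/mnmP => -[[|[|[|//]]] jlt]; rewrite multinomE /=;
  by congr (m _); exact: val_inj.
Qed.

Definition box3 (d : 'I_3 -> nat) : seq (nat * nat * nat) :=
  [seq (xy, z) |
    xy <- [seq (x, y) | x <- iota 0 (d ox).+1, y <- iota 0 (d oy).+1],
    z <- iota 0 (d oz).+1].

(** Triples of bounded exponents turn sums over [Qmonomials] into iterated sums over the three axes,
    and make the count a product. *)
Lemma perm_Qmonomials (d : 'I_3 -> nat) :
  perm_eq (Qmonomials d) [seq mnm3 x | x <- box3 d].
Proof.
have mnm3_inj : injective mnm3.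
  move=> [[x y] z] [[x' y'] z'].
  exact: (congr1 (fun m : multinom 3 => (m ox, m oy, m oz))).
apply: uniq_perm; first exact: Qmonomials_uniq.
  rewrite (map_inj_uniq mnm3_inj).
  by rewrite !allpairs_uniq ?iota_uniq// => -[? ?] [? ?].
move=> m; rewrite mem_Qmonomials; apply/forallP/mapP; rewrite /box3.
  move=> md; exists (m ox, m oy, m oz); last exact: mnm3E.
  by rewrite !allpairs_f// mem_iota ltnS md.
move=> [? /allpairsP[[? z] [/allpairsP[[x y] [+ + ->]] + ->]] ->].
rewrite !mem_iota !add0n !ltnS => xd yd zd.
by apply: forall_ord3; [exact: xd|exact: yd|exact: zd].
Qed.

Lemma size_Qmonomials (d : 'I_3 -> nat) :
  size (Qmonomials d) = ((d ox).+1 * (d oy).+1 * (d oz).+1)%N.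
Proof.
by rewrite (perm_size (perm_Qmonomials d)) size_map !size_allpairs !size_iota.
Qed.

(** Monomials of the box outside the support have coefficient zero. The sum over x is innermost
    because [tensor_unisolvent] eliminates x first. *)
Lemma sum_msupp_box (R : fieldType) (d : 'I_3 -> nat) (f : mpoly 3 R)
    (G : multinom 3 -> R) : f \in Qpred d ->
  \sum_(m <- msupp f) mcoeff m f * G m =
  \sum_(z < (d oz).+1) \sum_(y < (d oy).+1) \sum_(x < (d ox).+1)
     mcoeff (mnm3 (x : nat, y : nat, z : nat)) f *
       G (mnm3 (x : nat, y : nat, z : nat)).
Proof.
move=> /QpredP fd.
transitivity (\sum_(m <- Qmonomials d) mcoeff m f * G m).
  rewrite [RHS](bigID (mem (msupp f)))/= [X in _ + X]big1 ?addr0; last first.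
    by move=> m mf; rewrite memN_msupp_eq0 ?mul0r.
  rewrite -[RHS]big_filter; apply: perm_big; apply: uniq_perm.
  - exact: msupp_uniq.
  - by rewrite filter_uniq// Qmonomials_uniq.
  - move=> m; rewrite mem_filter mem_Qmonomials andb_idr// => mf.
    by apply/forallP; apply: fd; rewrite -mcoeff_msupp.
rewrite (perm_big _ (perm_Qmonomials d)) big_map /box3 big_allpairs big_allpairs.
pose F x y z := mcoeff (mnm3 (x, y, z)) f * G (mnm3 (x, y, z)).
transitivity (\sum_(0 <= x < (d ox).+1) \sum_(0 <= y < (d oy).+1)
   \sum_(0 <= z < (d oz).+1) F x y z).
  by rewrite /index_iota !subn0.
(* Three exchanges take the order xyz through yxz and yzx to zyx. *)
rewrite big_mkord; under eq_bigr do rewrite big_mkord; rewrite exchange_big/=.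
under eq_bigr do under eq_bigr do rewrite big_mkord.
under eq_bigr do rewrite exchange_big/=.
by rewrite exchange_big.
Qed.

(** [w j t n] is the value of the one-variable functional [t] on the n-th power of x_j. For fixed
    exponents in y and z, unisolvence in x replaces a coefficient by its sums against the
    functionals in x. These sums serve as coefficients in y, then likewise in z, where the full
    tensor functional appears. *)
Lemma tensor_unisolvent (R : fieldType) (I : Type) (d : 'I_3 -> nat)
    (w : 'I_3 -> I -> nat -> R) (valid : 'I_3 -> I -> Prop) (f : mpoly 3 R) :
  f \in Qpred d ->
  (forall j (c : nat -> R),
     (forall t, valid j t -> \sum_(n < (d j).+1) c n * w j t n = 0) ->
     forall n, (n < (d j).+1)%N -> c n = 0) ->
  (forall t : 'I_3 -> I, (forall j, valid j (t j)) ->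
     \sum_(m <- msupp f) mcoeff m f * \prod_j w j (t j) (m j) = 0) ->
  f = 0.
Proof.
move=> fd uni f0; apply/mpolyP => m; rewrite mcoeff0.
have [mf|/memN_msupp_eq0//] := boolP (m \in msupp f).
have md j : (m j < (d j).+1)%N.
  by rewrite ltnS; apply: (QpredP _ _ fd); rewrite -mcoeff_msupp.
rewrite (mnm3E m).
apply: (uni ox (fun x => mcoeff (mnm3 (x, m oy, m oz)) f)) (md ox) => tx vx.
apply: (uni oy (fun y => \sum_(x < (d ox).+1)
  mcoeff (mnm3 (x : nat, y, m oz)) f * w ox tx x)) (md oy) => ty vy.
apply: (uni oz (fun z => \sum_(y < (d oy).+1) (\sum_(x < (d ox).+1)
  mcoeff (mnm3 (x : nat, y : nat, z)) f * w ox tx x) * w oy ty y)) (md oz)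
  => tz vz.
pose t (j : 'I_3) := if j == ox then tx else if j == oy then ty else tz.
have vt : forall j, valid j (t j) by apply: forall_ord3.
rewrite -[RHS](f0 t vt) (sum_msupp_box _ fd).
apply: eq_bigr => z _; rewrite mulr_suml; apply: eq_bigr => y _.
rewrite !mulr_suml; apply: eq_bigr => x _.
by rewrite big_ord3 !multinomE !mulrA.
Qed.

(** * Integrals over products *)

Section ProductIntegral.
Context d1 d2 (T1 : measurableType d1) (T2 : measurableType d2) (R : realType).
Variables (m1 : {sigma_finite_measure set T1 -> \bar R})
  (m2 : {sigma_finite_measure set T2 -> \bar R}).
Variables (f : T1 -> R) (g : T2 -> R).

Let fg := fun z : T1 * T2 => (f z.1 * g z.2)%:E.

(** By Tonelli the integral of the absolute value is a product of two finite integrals. *)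
Lemma integrable_tensorT : m1.-integrable setT (EFin \o f) ->
  m2.-integrable setT (EFin \o g) -> (m1 \x m2)%E.-integrable setT fg.
Proof.
move=> fi gi.
have mf : measurable_fun setT f.
  by apply/measurable_EFinP; exact: measurable_int fi.
have mg : measurable_fun setT g.
  by apply/measurable_EFinP; exact: measurable_int gi.
have mfg : measurable_fun setT fg.
  apply/measurable_EFinP; apply: measurable_funM.
    by apply: (measurableT_comp mf).
  by apply: (measurableT_comp mg).
apply/integrable12ltyP => //.
have fL : (\int[m1]_x `|(f x)%:E| < +oo)%E by case/integrableP: fi.
have gL : (\int[m2]_y `|(g y)%:E| < +oo)%E by case/integrableP: gi.
have gfin : (\int[m2]_y `|(g y)%:E|)%E \is a fin_num.
  by rewrite ge0_fin_numE// integral_ge0.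
rewrite [ltLHS](_ : _ = \int[m1]_x (`|(f x)%:E| * \int[m2]_y `|(g y)%:E|))%E.
  rewrite ge0_integralZr//; last 2 first.
  - by apply/measurable_EFinP; exact: measurableT_comp.
  - exact: integral_ge0.
  rewrite -(fineK gfin) muleC; apply: lte_mul_pinfty => //.
  by rewrite fineK// integral_ge0.
apply: eq_integral => x _; rewrite -ge0_integralZl//; last first.
  by apply/measurable_EFinP; exact: measurableT_comp.
by apply: eq_integral => y _; rewrite /fg/= normrM EFinM.
Qed.

Lemma Rintegral_tensorT : m1.-integrable setT (EFin \o f) ->
  m2.-integrable setT (EFin \o g) ->
  \int[(m1 \x m2)%E]_z (f z.1 * g z.2) = (\int[m1]_x f x) * (\int[m2]_y g y).
Proof.
move=> fi gi; rewrite /Rintegral -integral12_prod_meas1; last first.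
  exact: integrable_tensorT.
rewrite /fubini_F/=.
under eq_integral do rewrite (integralZl measurableT gi).
have gfin := integrable_fin_num measurableT gi.
rewrite -(fineK gfin) (integralZr measurableT fi) fineM//.
exact: integrable_fin_num fi.
Qed.

End ProductIntegral.

Section ProductIntegralOn.
Context d1 d2 (T1 : measurableType d1) (T2 : measurableType d2) (R : realType).
Variables (m1 : {sigma_finite_measure set T1 -> \bar R})
  (m2 : {sigma_finite_measure set T2 -> \bar R}).
Variables (D1 : set T1) (D2 : set T2) (f : T1 -> R) (g : T2 -> R).
Hypotheses (fi : m1.-integrable D1 (EFin \o f))
  (gi : m2.-integrable D2 (EFin \o g)).
Hypotheses (mD1 : measurable D1) (mD2 : measurable D2).

Let h : T1 * T2 -> R := fun z => f z.1 * g z.2.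

(** Restriction to a rectangle factors, so the results on the whole space, applied to extensions by
    zero, carry over to [D1] and [D2]. *)
Let restrE : h \_ (D1 `*` D2) =
  fun z => (f \_ D1) z.1 * (g \_ D2) z.2.
Proof.
apply/funext => -[x y]; rewrite /patch /h in_setX.
by case: (x \in D1); case: (y \in D2); rewrite /= ?mulr0 ?mul0r.
Qed.

Let fTi : m1.-integrable setT (EFin \o (f \_ D1)).
Proof. by rewrite -restrict_EFin; exact: (integrable_mkcond _ mD1).1 fi. Qed.

Let gTi : m2.-integrable setT (EFin \o (g \_ D2)).
Proof. by rewrite -restrict_EFin; exact: (integrable_mkcond _ mD2).1 gi. Qed.

Lemma integrable_tensor : (m1 \x m2)%E.-integrable (D1 `*` D2)
  (EFin \o (fun z : T1 * T2 => f z.1 * g z.2)).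
Proof.
apply: (integrable_mkcond _ (measurableX mD1 mD2)).2.
rewrite (restrict_EFin h) restrE.
exact: integrable_tensorT.
Qed.

Lemma Rintegral_tensor :
  \int[(m1 \x m2)%E]_(z in D1 `*` D2) (f z.1 * g z.2) =
  (\int[m1]_(x in D1) f x) * (\int[m2]_(y in D2) g y).
Proof.
rewrite (Rintegral_mkcond _ _ h) restrE Rintegral_tensorT//.
by rewrite -!Rintegral_mkcond.
Qed.

End ProductIntegralOn.

Section SigmaFiniteProduct.
Context d1 d2 (T1 : measurableType d1) (T2 : measurableType d2) (R : realType).
Variables (m1 : {sigma_finite_measure set T1 -> \bar R})
  (m2 : {sigma_finite_measure set T2 -> \bar R}).

(* [m1 \x m2] under a name of its own: the library attaches the sigma-finite
   structure of the bare product only to products of subprobabilities. *)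
Definition sigma_finite_product : set (T1 * T2) -> \bar R := (m1 \x m2)%E.

HB.instance Definition _ := measure_function.Measure.on sigma_finite_product.

Lemma sigma_finite_productT : sigma_finite setT sigma_finite_product.
Proof.
have [F FT Foo] := sigma_finiteT m1; have [G GT Goo] := sigma_finiteT m2.
(* The covering rectangles are enumerated through codes of pairs; an integer that codes no pair gets
   the empty set. *)
exists (fun n => if unpickle n is Some (i, j) then F i `*` G j else set0).
  apply/esym/seteqP; split=> // -[x y] _.
  have [i _ Fix] : (\bigcup_i F i) x by rewrite -FT.
  have [j _ Gjy] : (\bigcup_j G j) y by rewrite -GT.
  by exists (pickle (i, j)) => //=; rewrite pickleK.
move=> n; case: unpickle => [[i j]|]; last by rewrite measure0.
have [mF Fi] := Foo i; have [mG Gj] := Goo j.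
split; first exact: measurableX.
rewrite /sigma_finite_product product_measure1E//.
by rewrite lte_mul_pinfty// ge0_fin_numE.
Qed.

HB.instance Definition _ := Measure_isSigmaFinite.Build _ _ _
  sigma_finite_product sigma_finite_productT.

End SigmaFiniteProduct.

(** * One variable *)

Section PowerMoment.
Context (R : realType).
Let mu := @lebesgue_measure R.

Lemma integrable_horner (a b : R) (p : {poly R}) :
  mu.-integrable `[a, b] (EFin \o (fun x => p.[x])).
Proof.
apply: continuous_compact_integrable; first exact: segment_compact.
by apply: continuous_subspaceT; exact: continuous_horner.
Qed.

(** A nonnegative function with zero integral vanishes almost everywhere. If [p] were nonzero, its
    roots would be finite in number, and two null sets would cover an interval of positive
    length. *)
Lemma Rintegral_poly_eq0 (a b : R) (p : {poly R}) : a < b ->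
  (forall x, x \in `[a, b] -> 0 <= p.[x]) ->
  \int[mu]_(x in `[a, b]) p.[x] = 0 -> p = 0.
Proof.
move=> ab p0 Ip; apply/eqP/negPn/negP => pN0.
have pi := integrable_horner a b p.
have /ae_eq_integral_abs : (\int[mu]_(x in `[a, b]) `|(p.[x])%:E| = 0)%E.
  rewrite -[RHS]/(0%:E) -Ip /Rintegral fineK.
    apply: eq_integral => x; rewrite inE => xab.
    by rewrite gee0_abs// lee_fin p0.
  exact: integrable_fin_num.
move=> /(_ (measurable_itv _) (measurable_int _ pi)) [N [mN N0 subN]].
have abN : `[a, b]%classic `<=` N `|` [set x | root p x].
  move=> x xab; have [rx|rx] := boolP (root p x); first by right.
  by left; apply: subN => /= /(_ xab) [] /eqP; apply/negP.
have rfin : countable [set x | root p x].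
  (* An infinite root set would contain at least [size p] distinct roots. *)
  apply: finite_set_countable; apply: contrapT => rinf.
  have [B Bp Bs] := infinite_set_fset (size p) rinf.
  have rB : all (root p) (finmap.enum_fset B).
    by apply/allP => x xB; exact: Bp.
  by have := max_poly_roots pN0 rB (finmap.fset_uniq B); rewrite ltnNge Bs.
set Z := [set x | root p x] in abN rfin.
have mZ : measurable (Z : set (measurableTypeR R)) by exact: countable_measurable.
have Z0 : mu Z = 0%E by exact: countable_lebesgue_measure0.
have : mu `[a, b]%classic = 0%E.
  have NZ0 : mu (N `|` Z) = 0%E by exact: null_set_setU.
  apply/eqP; rewrite -measure_le0 -NZ0 le_measure ?inE//.
  exact: measurableU.
rewrite /mu lebesgue_measure_itv/= lte_fin ab -EFinB => -[] /eqP.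
by rewrite subr_eq0 eq_sym (lt_eqF ab).
Qed.

Lemma RintegralD_horner (a b : R) (p q : {poly R}) :
  \int[mu]_(x in `[a, b]) (p + q).[x] =
  \int[mu]_(x in `[a, b]) p.[x] + \int[mu]_(x in `[a, b]) q.[x].
Proof.
under eq_Rintegral do rewrite hornerD.
by apply: RintegralD; [exact: measurable_itv|exact: integrable_horner..].
Qed.

Lemma RintegralZ_horner (a b c : R) (p : {poly R}) :
  \int[mu]_(x in `[a, b]) (c *: p).[x] = c * \int[mu]_(x in `[a, b]) p.[x].
Proof.
under eq_Rintegral do rewrite hornerZ.
by apply: RintegralZl; [exact: measurable_itv|exact: integrable_horner].
Qed.

(* The value on t^n of a functional on polynomials in t: [inl c] evaluates at an
   endpoint (b if c, else a), [inr s] is the moment against t^s on [a, b]. *)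
Definition node (a b : R) (t : bool + nat) (n : nat) : R :=
  match t with
  | inl c => (if c then b else a) ^+ n
  | inr s => \int[mu]_(x in `[a, b]) x ^+ (n + s)
  end.

Lemma Rintegral_poly0 (a b : R) :
  \int[mu]_(x in `[a, b]) (0 : {poly R}).[x] = 0.
Proof. by rewrite -(scale0r 0) RintegralZ_horner mul0r. Qed.

Lemma sum_node_eval a b (e : bool) N (c : nat -> R) :
  \sum_(n < N) c n * node a b (inl e) n =
  (\poly_(n < N) c n).[if e then b else a].
Proof. by rewrite horner_poly. Qed.

Lemma sum_node_moment a b s N (c : nat -> R) :
  \sum_(n < N) c n * node a b (inr s) n =
  \int[mu]_(x in `[a, b]) ((\poly_(n < N) c n) * 'X^s).[x].
Proof.
rewrite poly_def mulr_suml.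
elim/big_rec2 : _ => [|n y p _ ->]; first by rewrite Rintegral_poly0.
rewrite -scalerAl RintegralD_horner RintegralZ_horner; congr (_ * _ + _).
by rewrite /node; apply: eq_Rintegral => x _; rewrite !hornerE exprD.
Qed.

(** Since [p] is a combination of the powers below [N], it is orthogonal to itself for the weight
    [w]; so [w * p * p] is nonnegative on [a, b] with integral zero. *)
Lemma orthogonal_poly_eq0 a b N (w p : {poly R}) : a < b -> w != 0 ->
  (forall x, x \in `[a, b] -> 0 <= w.[x]) -> (size p <= N)%N ->
  (forall s, (s < N)%N -> \int[mu]_(x in `[a, b]) (w * p * 'X^s).[x] = 0) ->
  p = 0.
Proof.
move=> ab wN0 w0 pN orth.
suff /eqP : w * p * p = 0.
  by rewrite !mulf_eq0 (negPf wN0)/= orbb => /eqP.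
apply: (Rintegral_poly_eq0 ab) => [x xab|].
  by rewrite !hornerE -mulrA mulr_ge0 ?w0// -expr2 sqr_ge0.
(* Only the last factor [p] is expanded in monomials. *)
have {2}-> : p = \sum_(s < N) p`_s *: 'X^s.
  rewrite -poly_def; apply/polyP => s; rewrite coef_poly.
  by case: ltnP => // Ns; rewrite nth_default// (leq_trans pN).
rewrite mulr_sumr.
elim/big_rec : _ => [|s q _ IH]; first exact: Rintegral_poly0.
by rewrite RintegralD_horner IH -scalerAr RintegralZ_horner orth// mulr0 addr0.
Qed.

Lemma coef_poly_eq0 N (c : nat -> R) : \poly_(n < N) c n = 0 ->
  forall n, (n < N)%N -> c n = 0.
Proof. by move=> c0 n nN; have := coef_poly N c n; rewrite c0 coef0 nN. Qed.

Lemma node_moment_unisolvent a b N (c : nat -> R) : a < b ->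
  (forall s, (s < N)%N -> \sum_(n < N) c n * node a b (inr s) n = 0) ->
  forall n, (n < N)%N -> c n = 0.
Proof.
move=> ab c0; apply/coef_poly_eq0/(orthogonal_poly_eq0 (w := 1) ab) => //.
- exact: oner_neq0.
- by move=> x _; rewrite hornerC.
- by move=> s sN; rewrite mul1r -sum_node_moment c0.
Qed.

(** Vanishing at both endpoints splits off the nonnegative weight (x - a)(b - x). The quotient has
    at most [N] coefficients, and the [N] moments say that it is orthogonal to all powers below [N]
    for this weight. *)
Lemma node_end_moment_unisolvent a b N (c : nat -> R) : a < b ->
  (forall e, \sum_(n < N.+2) c n * node a b (inl e) n = 0) ->
  (forall s, (s < N)%N -> \sum_(n < N.+2) c n * node a b (inr s) n = 0) ->
  forall n, (n < N.+2)%N -> c n = 0.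
Proof.
move=> ab ce cs; apply/coef_poly_eq0; set p := poly _ _.
have sp : (size p <= N.+2)%N by exact: size_poly.
have pa : root p a by apply/eqP; have := ce false; rewrite sum_node_eval.
have pb : root p b by apply/eqP; have := ce true; rewrite sum_node_eval.
(* The second factor is [b%:P - 'X], nonnegative on [a, b]; the quotient absorbs the minus sign. *)
have [q pE] : exists q, p = (('X - a%:P) * (b%:P - 'X)) * q.
  have /factor_theorem[r rE] := pa.
  have : root r b.
    move: pb; rewrite rE rootM root_XsubC => /orP[//|/eqP ba].
    by rewrite ba ltxx in ab.
  move=> /factor_theorem[q qE]; exists (- q); rewrite rE qE.
  by rewrite -(opprB 'X) !mulrN mulNr opprK -mulrA mulrC [('X - b%:P) * _]mulrC.
set w := ('X - _) * _ in pE.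
have wN0 : w != 0.
  rewrite mulf_eq0 polyXsubC_eq0/=.
  by rewrite -(opprB 'X) oppr_eq0 polyXsubC_eq0.
suff q0 : q = 0 by rewrite pE q0 mulr0.
apply: (orthogonal_poly_eq0 (N := N) ab wN0) => [x /itvP xab||s sN].
- by rewrite !hornerE mulr_ge0// subr_ge0 xab.
(* The weight has size 3, so [size p <= N.+2] gives [size q <= N]. *)
- have [->|qN0] := eqVneq q 0; first by rewrite size_poly0.
  move: sp; rewrite pE size_mul// /w size_mul ?polyXsubC_eq0//; last first.
    by rewrite -(opprB 'X) oppr_eq0 polyXsubC_eq0.
  by rewrite -(opprB 'X) size_polyN !size_XsubC.
- by rewrite -pE -sum_node_moment cs.
Qed.

End PowerMoment.

(** * Moments of polynomials in three variables *)

Section PolynomialMoment.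
Context d (T : measurableType d) (R : realType).
Variables (nu : {measure set T -> \bar R}) (D : set T) (pt : T -> 'I_3 -> R).
Hypothesis mD : measurable D.
Hypothesis Xint : forall m : multinom 3,
  nu.-integrable D (EFin \o (fun x => meval (pt x) (mpolyX R m))).
Implicit Types f g p : mpoly 3 R.

(** [pt] parametrises an edge, a face or the cell, so that [edge_moment], [face_moment] and
    [cell_moment] are all instances. *)
Definition moment p f : R :=
  \int[nu]_(x in D) (meval (pt x) f * meval (pt x) p).

Lemma integrable_meval g :
  nu.-integrable D (EFin \o (fun x => meval (pt x) g)).
Proof.
rewrite [X in EFin \o X](_ : _ = fun x =>
    \sum_(m <- msupp g) mcoeff m g * meval (pt x) (mpolyX R m)); last first.
  by apply/funext => x; rewrite mevalE; apply: eq_bigr => m _; rewrite mevalX.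
rewrite (_ : EFin \o _ = fun x => \sum_(m <- msupp g)
    ((mcoeff m g)%:E * (meval (pt x) (mpolyX R m))%:E)%E)%E; last first.
  apply/funext => x /=; rewrite -sumEFin.
  by apply: eq_bigr => m _; rewrite EFinM.
apply: (integrable_sum mD) => m _.
exact: (integrableZl mD _ (Xint m)).
Qed.

Lemma Rintegral_meval_linear c g h :
  \int[nu]_(x in D) meval (pt x) (c *: g + h) =
  c * (\int[nu]_(x in D) meval (pt x) g) + \int[nu]_(x in D) meval (pt x) h.
Proof.
rewrite -(RintegralZl c mD (integrable_meval g)).
under eq_Rintegral do rewrite mevalD mevalZ.
have gi := integrable_meval (c *: g).
apply: (RintegralD mD _ (integrable_meval h)).
by apply: eq_integrable gi => // x _ /=; rewrite mevalZ.
Qed.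

Lemma momentE p f : moment p f = \int[nu]_(x in D) meval (pt x) (f * p).
Proof. by apply: eq_Rintegral => x _; rewrite mevalM. Qed.

Lemma moment_linearl p : linear (moment p : mpoly 3 R -> R^o).
Proof.
by move=> c f g; rewrite !momentE mulrDl -scalerAl Rintegral_meval_linear.
Qed.

Lemma moment_linearr f : linear ((fun p => moment p f) : mpoly 3 R -> R^o).
Proof.
by move=> c p q; rewrite !momentE mulrDr -scalerAr Rintegral_meval_linear.
Qed.

(** Multiplying by a monomial shifts exponents, so a product formula for the integrals of monomials
    makes the moment a tensor functional of the coefficients of [f]. *)
Lemma moment_mpolyX (W : 'I_3 -> nat -> R) (f : mpoly 3 R) (p : multinom 3) :
  (forall m : multinom 3,
     \int[nu]_(x in D) meval (pt x) (mpolyX R m) = \prod_j W j (m j)) ->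
  moment (mpolyX R p) f =
  \sum_(m <- msupp f) mcoeff m f * \prod_j W j (m j + p j)%N.
Proof.
move=> WE; rewrite momentE {1}(mpolyE f) mulr_suml.
have I0 : \int[nu]_(x in D) meval (pt x) 0 = 0.
  (* With scalar -1, linearity reads I = -I + I for the integral I of zero. *)
  have := Rintegral_meval_linear (-1) 0 0.
  by rewrite scaler0 addr0 mulN1r addNr.
elim/big_rec2 : _ => [//|m y q _ <-].
rewrite -scalerAl -mpolyXD Rintegral_meval_linear WE; congr (_ * _ + _).
by apply: eq_bigr => j _; rewrite mnmDE.
Qed.

(** The moment is linear in the test polynomial, so its kernel contains the span of [B]; an
    arbitrary basis may be traded for monomials. *)
Lemma moment_basis0 (deg : 'I_3 -> nat) (B : seq (Qpoly R deg)) f :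
  basis_of fullv B -> (forall p : Qpoly R deg, p \in B -> moment p f = 0) ->
  forall m : multinom 3, (forall j, (m j <= deg j)%N) ->
    moment (mpolyX R m) f = 0.
Proof.
move=> Bb B0 m mdeg.
have mQ : mpolyX R m \in Qpred deg.
  by apply/QpredP => n; rewrite mcoeffX pnatr_eq0 eqb0 negbK => /eqP <-.
pose L (p : Qpoly R deg) : R^o := moment p f.
have LL : linear L by move=> c p q; exact: moment_linearr.
have LE := linfun_linearE LL.
have : QPoly mQ \in lker (linfun L).
  apply: (subvP _ _ (memvf (QPoly mQ))).
  rewrite -(span_basis Bb); apply/span_subvP => p pB.
  by rewrite memv_ker LE; apply/eqP; exact: B0.
by rewrite memv_ker LE => /eqP.
Qed.

End PolynomialMoment.

(** * Integrals of monomials over edges, faces and the cell *)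

Section CuboidMoments.
Context (R : realType) (a b : 'I_3 -> R).
Let mu := @lebesgue_measure R.

Let mI (c e : R) :
  measurable (`[c, e]%classic : set (measurableTypeR R)).
Proof. exact: measurable_itv. Qed.

(* The directions in [S] are integrated, the others are frozen at the vertex
   coded by [v]. *)
Definition mixed_node (S : pred 'I_3) (v : {ffun 'I_3 -> bool}) (j : 'I_3) :
    nat -> R :=
  node (a j) (b j) (if S j then inr 0 else inl (v j)).

Lemma integrable_exprn (c e : R) n :
  mu.-integrable `[c, e] (EFin \o (fun x => x ^+ n)).
Proof.
have := integrable_horner c e 'X^n.
by apply: eq_integrable => // x _ /=; rewrite hornerXn.
Qed.

Lemma mixed_nodeT (S : pred 'I_3) v j n : S j ->
  mixed_node S v j n = \int[mu]_(x in `[a j, b j]) x ^+ n.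
Proof. by move=> Sj; rewrite /mixed_node Sj /= addn0. Qed.

Lemma mixed_nodeF (S : pred 'I_3) v j n : ~~ S j ->
  mixed_node S v j n = vertex a b v j ^+ n.
Proof. by move=> /negPf Sj; rewrite /mixed_node Sj. Qed.

Lemma edge_monomial i v (m : multinom 3) :
  mu.-integrable `[a i, b i]
    (EFin \o (fun s => meval (edge_point a b i v s) (mpolyX R m))) /\
  \int[mu]_(s in `[a i, b i]) meval (edge_point a b i v s) (mpolyX R m) =
    \prod_j mixed_node (pred1 i) v j (m j).
Proof.
pose c := \prod_(j | j != i) vertex a b v j ^+ m j.
have E s : meval (edge_point a b i v s) (mpolyX R m) = c * s ^+ m i.
  rewrite mevalX (bigD1 i)//= /edge_point eqxx mulrC; congr (_ * _).
  by apply: eq_bigr => j /negPf ->.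
have Xi := integrable_exprn (a i) (b i) (m i).
split.
  have := integrableZl (mI _ _) c Xi.
  by apply: eq_integrable => // s _ /=; rewrite E.
under eq_Rintegral do rewrite E.
rewrite (RintegralZl c (mI _ _) Xi) [RHS](bigD1 i)//= mulrC.
rewrite mixed_nodeT/= ?eqxx//; congr (_ * _).
by apply: eq_bigr => j ji; rewrite mixed_nodeF.
Qed.

Lemma face_monomial i j v (m : multinom 3) : j != i ->
  (mu \x mu)%E.-integrable (`[a i, b i] `*` `[a j, b j])
    (EFin \o (fun st => meval (face_point a b i j v st) (mpolyX R m))) /\
  \int[(mu \x mu)%E]_(st in `[a i, b i] `*` `[a j, b j])
      meval (face_point a b i j v st) (mpolyX R m) =
    \prod_l mixed_node (pred2 i j) v l (m l).
Proof.
move=> ji; pose c := \prod_(l | (l != i) && (l != j)) vertex a b v l ^+ m l.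
have E st : meval (face_point a b i j v st) (mpolyX R m) =
    st.1 ^+ m i * (c * st.2 ^+ m j).
  rewrite mevalX (bigD1 i)//= /face_point eqxx; congr (_ * _).
  rewrite (bigD1 j)//= (negPf ji) eqxx mulrC; congr (_ * _).
  by apply: eq_bigr => l /andP[/negPf -> /negPf ->].
have Xi := integrable_exprn (a i) (b i) (m i).
have Xj := integrable_exprn (a j) (b j) (m j).
have cXj : mu.-integrable `[a j, b j] (EFin \o (fun t : R => c * t ^+ m j)).
  have := integrableZl (mI _ _) c Xj.
  by apply: eq_integrable => // s _ /=.
split.
  have := integrable_tensor Xi cXj (mI _ _) (mI _ _).
  apply: eq_integrable => [|s _ /=]; last by rewrite E.
  by apply: measurableX; exact: mI.
under eq_Rintegral do rewrite E.
rewrite [LHS](Rintegral_tensor Xi cXj (mI _ _) (mI _ _)).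
rewrite (RintegralZl c (mI _ _) Xj) [RHS](bigD1 i)//= (bigD1 j)//=.
rewrite mixed_nodeT/= ?eqxx//; congr (_ * _).
rewrite mixed_nodeT/= ?eqxx ?orbT// mulrC; congr (_ * _).
apply: eq_bigr => l /andP[/negPf li /negPf lj].
by rewrite mixed_nodeF//= li lj.
Qed.

Lemma cell_monomial v (m : multinom 3) :
  (mu \x mu \x mu)%E.-integrable
    (`[a ox, b ox] `*` `[a oy, b oy] `*` `[a oz, b oz])
    (EFin \o (fun x => meval (cell_point x) (mpolyX R m))) /\
  \int[(mu \x mu \x mu)%E]_(x in
      `[a ox, b ox] `*` `[a oy, b oy] `*` `[a oz, b oz])
      meval (cell_point x) (mpolyX R m) =
    \prod_l mixed_node predT v l (m l).
Proof.
have E (x : R * R * R) : meval (cell_point x) (mpolyX R m) =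
    (x.1.1 ^+ m ox * x.1.2 ^+ m oy) * x.2 ^+ m oz.
  by rewrite mevalX big_ord3.
have X j := integrable_exprn (a j) (b j) (m j).
have XY := integrable_tensor (X ox) (X oy) (mI _ _) (mI _ _).
(* The named product supplies the sigma-finiteness that the outer Fubini step asks of its first
   measure. *)
pose mumu := sigma_finite_product mu mu.
have mXY := measurableX (mI (a ox) (b ox)) (mI (a oy) (b oy)).
split.
  have := integrable_tensor (m1 := mumu) XY (X oz) mXY (mI _ _).
  apply: eq_integrable => [|s _ /=]; last by rewrite E.
  by apply: measurableX => //; exact: mI.
under eq_Rintegral do rewrite E.
rewrite [LHS](Rintegral_tensor (m1 := mumu) XY (X oz) mXY (mI _ _)).
rewrite [X in X * _](Rintegral_tensor (X ox) (X oy) (mI _ _) (mI _ _)).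
by rewrite big_ord3 !mixed_nodeT.
Qed.

End CuboidMoments.

(** * From vanishing moments to a vanishing component *)

Section Vanishing.
Context (R : realType) (a b : 'I_3 -> R).

(** If [t] evaluates at the endpoints coded by [v] off [S] and takes moments along [S], the tensor
    functional is the moment against a single monomial, which lies in the span of [B]. *)
Lemma sum_node_eq0 d (T : measurableType d) (nu : {measure set T -> \bar R})
    (D : set T) (pt : T -> 'I_3 -> R) (S : pred 'I_3) (v : {ffun 'I_3 -> bool})
    (deg : 'I_3 -> nat) (B : seq (Qpoly R deg)) (f : mpoly 3 R)
    (t : 'I_3 -> bool + nat) :
  measurable D ->
  (forall m : multinom 3,
     nu.-integrable D (EFin \o (fun x => meval (pt x) (mpolyX R m))) /\
     \int[nu]_(x in D) meval (pt x) (mpolyX R m) =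
       \prod_j mixed_node a b S v j (m j)) ->
  basis_of fullv B ->
  (forall p : Qpoly R deg, p \in B -> moment nu D pt p f = 0) ->
  (forall j, match t j with
             | inl e => ~~ S j && (e == v j)
             | inr s => S j && (s <= deg j)%N
             end) ->
  \sum_(m <- msupp f) mcoeff m f * \prod_j node (a j) (b j) (t j) (m j) = 0.
Proof.
move=> mD mono Bb B0 tS.
have Xint m := (mono m).1; have XE m := (mono m).2.
pose p : multinom 3 :=
  Multinom (mktuple (fun j => if t j is inr s then s else 0%N)).
have pdeg j : (p j <= deg j)%N.
  by rewrite mnmE; have := tS j; case: (t j) => [//|s /andP[]].
transitivity (moment nu D pt (mpolyX R p) f); last first.
  exact: (moment_basis0 mD Xint Bb B0 pdeg).
rewrite (moment_mpolyX mD Xint _ _ XE).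
apply: eq_bigr => m _; congr (_ * _); apply: eq_bigr => j _.
rewrite mnmE; have := tS j; case: (t j) => [e /andP[Sj /eqP ->]|s /andP[Sj _]].
  by rewrite /mixed_node (negPf Sj) addn0.
by rewrite /mixed_node Sj /= addn0.
Qed.

(** Here k is [K.+3]. Each tensor functional is an edge, face or cell moment according to how many
    axes other than x_i carry a moment. *)
Lemma component_eq0 (K : nat) (i : 'I_3) (f : mpoly 3 R)
    (E : {ffun 'I_3 -> bool} -> seq (Qpoly R (edge_deg K.+3 i)))
    (F : forall j : 'I_3, {ffun 'I_3 -> bool} ->
       seq (Qpoly R (face_deg K.+3 i j)))
    (C : seq (Qpoly R (cell_deg K.+3 i))) :
  (forall m, a m < b m) -> f \in Qpred (shape_deg K.+3 i) ->
  (forall v, v \in edges i -> basis_of fullv (E v)) ->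
  (forall j v, j != i -> v \in faces i j -> basis_of fullv (F j v)) ->
  basis_of fullv C ->
  (forall v p, v \in edges i -> p \in E v -> edge_moment a b i v p f = 0) ->
  (forall j v p, j != i -> v \in faces i j -> p \in F j v ->
     face_moment a b i j v p f = 0) ->
  (forall p, p \in C -> cell_moment a b p f = 0) ->
  f = 0.
Proof.
move=> hab fd Eb Fb Cb E0 F0 C0.
have mI (c e : R) : measurable (`[c, e]%classic : set (measurableTypeR R)).
  exact: measurable_itv.
pose valid (j : 'I_3) (t : bool + nat) : Prop :=
  match t with
  | inl _ => j != i
  | inr s => (s <= if j == i then K.+1 else K)%N
  end.
apply: (tensor_unisolvent (w := fun j => node (a j) (b j)) (valid := valid) fd).
  move=> j c; rewrite /valid /shape_deg; case: eqP => [_|_] c0.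
    apply: (node_moment_unisolvent (hab j)) => s sK.
    exact: (c0 (inr s)).
  (* Degree [K.+2] means [K.+3] coefficients: two endpoint values and [K.+1] moments. *)
  apply: (node_end_moment_unisolvent (N := K.+1) (hab j)) => [e|s sK].
    exact: (c0 (inl e)).
  exact: (c0 (inr s)).
move=> t tv.
(* Integrated directions get [false], which is how [edges] and [faces] code their vertex. *)
pose v : {ffun 'I_3 -> bool} := [ffun j => if t j is inl e then e else false].
pose isr j := if t j is inr _ then true else false.
have ti : isr i by rewrite /isr; have := tv i; rewrite /valid eqxx; case: (t i).
have vr j : isr j -> ~~ v j by rewrite /isr ffunE; case: (t j).
have [/existsP[j /andP[ji jr]]|/existsPn noj] :=
    boolP [exists j, (j != i) && isr j]; last first.
  (* Both other axes carry evaluations: an edge moment. *)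
  have vi : v \in edges i by rewrite mem_enum inE vr.
  apply: (sum_node_eq0 (S := pred1 i) (v := v) (mI _ _)
    (edge_monomial a b i v) (Eb v vi)) => [p pE|j].
    exact: E0.
  have := tv j; have := noj j; rewrite /isr /valid /edge_deg /= ffunE.
  case: (t j) => [e|s]; case: (eqVneq j i) => //= _ _;
    by rewrite ?eqxx ?subSS ?subn0.
have [/existsP[l /and3P[li lj lr]]|/existsPn nol] :=
    boolP [exists l, [&& l != i, l != j & isr l]]; last first.
  (* Only x_i and x_j carry moments: a face moment. *)
  have vij : v \in faces i j by rewrite mem_enum inE !vr.
  apply: (sum_node_eq0 (S := pred2 i j) (v := v)
    (measurableX (mI _ _) (mI _ _))
    (fun m => face_monomial a b v m ji) (Fb j v ji vij)) => [p pF|l].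
    exact: F0.
  have := tv l; have := nol l; rewrite /valid /face_deg /= ffunE.
  case: (eqVneq l i) => [->|li].
    by move: ti; rewrite /isr; case: (t i) => //= s _ _; rewrite !subSS subn0.
  case: (eqVneq l j) => [->|lj].
    by move: jr; rewrite /isr; case: (t j) => //= s _ _; rewrite !subSS subn0.
  by rewrite /isr; case: (t l) => //= e; rewrite eqxx.
(* All three axes carry moments: a cell moment. *)
apply: (sum_node_eq0 (S := predT) (v := v) _
    (cell_monomial a b v) Cb) => [|p pC|m].
- by apply: measurableX; [apply: measurableX|]; exact: mI.
- exact: C0.
have := tv m; have : isr m.
  by have := ord3_cover m ji li lj; rewrite !inE => /or3P[] /eqP ->.
rewrite /isr /valid /cell_deg; case: (t m) => //= s _.
by case: eqP => _; rewrite !subSS subn0.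
Qed.

End Vanishing.

(** * Counting the degrees of freedom *)

(** Coordinates are chosen independently: one choice where [A] holds, two elsewhere. *)
Lemma card_ffun_false (A : pred 'I_3) :
  #|[pred v : {ffun 'I_3 -> bool} | [forall j, A j ==> ~~ v j]]| =
  (2 ^ (~~ A ox) * 2 ^ (~~ A oy) * 2 ^ (~~ A oz))%N.
Proof.
transitivity (\prod_j 2 ^ (~~ A j))%N; last by rewrite big_ord3.
pose P j := [pred e : bool | A j ==> ~~ e].
transitivity #|family P|.
  by apply: eq_card => v; rewrite [LHS]inE; apply/forallP/familyP.
rewrite card_family foldrE big_map big_enum; apply: eq_bigr => j _.
rewrite /P -sum1_card big_mkcond big_bool.
by case: (A j).
Qed.

Lemma size_edges i : size (edges i) = 4%N.
Proof.
rewrite -cardE (eq_card (B := [pred v : {ffun 'I_3 -> bool} |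
  [forall j, pred1 i j ==> ~~ v j]])); last first.
  move=> v; rewrite !inE; apply/idP/forallP => [vi j|/(_ i)].
    by apply/implyP => /eqP ->.
  by rewrite /= eqxx.
by rewrite card_ffun_false; move: i; apply: forall_ord3.
Qed.

Lemma size_faces i j : j != i -> size (faces i j) = 2%N.
Proof.
move=> ji; rewrite -cardE (eq_card (B := [pred v : {ffun 'I_3 -> bool} |
  [forall l, pred2 i j l ==> ~~ v l]])); last first.
  move=> v; rewrite !inE; apply/andP/forallP => [[vi vj] l|vij].
    by apply/implyP => /orP[] /eqP ->.
  by have := (vij i, vij j); rewrite /= !eqxx orbT => -[].
by rewrite card_ffun_false; move: i j ji; do 2 elim/forall_ord3.
Qed.

Lemma size_basis_Qpoly (R : fieldType) (d : 'I_3 -> nat) (B : seq (Qpoly R d)) :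
  basis_of fullv B -> size B = ((d ox).+1 * (d oy).+1 * (d oz).+1)%N.
Proof.
move=> Bb; rewrite -size_Qmonomials.
by have := @vector.size_basis _ _ _ _ (in_tuple B) Bb; rewrite dimvf => <-.
Qed.

Lemma dim_shape_space (R : fieldType) k :
  \dim {: shape_space R k} = (\sum_i size (Qmonomials (shape_deg k i)))%N.
Proof. by rewrite dimvf big_ord3. Qed.

Lemma size_allpairs_cst (S : eqType) (T : S -> Type) (U : Type)
    (f : forall x, T x -> U) (s : seq S) (t : forall x, seq (T x)) n :
  (forall x, x \in s -> size (t x) = n) ->
  size [seq f x y | x <- s, y <- t x] = (size s * n)%N.
Proof.
move=> tn; rewrite size_allpairs_dep sumnE big_map -sum1_size big_distrl/=.
by rewrite !big_seq; apply: eq_bigr => x xs; rewrite mul1n tn.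
Qed.

(** * Unisolvence *)

Lemma component_linear (R : fieldType) k i :
  linear (fun q : shape_space R k => component q i).
Proof. by move=> c p q; move: i; apply: forall_ord3. Qed.

Lemma component_Qpred (R : fieldType) k (q : shape_space R k) i :
  component q i \in Qpred (shape_deg k i).
Proof.
move: i; apply: forall_ord3.
- exact: (valP q.1.1).
- exact: (valP q.1.2).
- exact: (valP q.2).
Qed.

Section Forms.
Context (R : realType) (a b : 'I_3 -> R) (k : nat).

Definition component_form (L : mpoly 3 R -> R) i : 'Hom(shape_space R k, R^o) :=
  linfun (fun q : shape_space R k => L (component q i) : R^o).

Lemma component_formE (L : mpoly 3 R -> R^o) i : linear L ->
  (fun q => component_form L i q : R) = fun q => L (component q i).
Proof.
move=> LL; apply/funext => q; apply: linfun_linearE => c x y.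
by rewrite component_linear LL.
Qed.

Let mI (c e : R) : measurable (`[c, e]%classic : set (measurableTypeR R)).
Proof. exact: measurable_itv. Qed.

Lemma edge_moment_linear i v p : linear (edge_moment a b i v p : _ -> R^o).
Proof.
apply: (moment_linearl (mI _ _)) => m.
exact: (edge_monomial a b i v m).1.
Qed.

Lemma face_moment_linear i j v p : j != i ->
  linear (face_moment a b i j v p : _ -> R^o).
Proof.
move=> ji; apply: (moment_linearl (measurableX (mI _ _) (mI _ _))) => m.
exact: (face_monomial a b v m ji).1.
Qed.

Lemma cell_moment_linear p : linear (cell_moment a b p : _ -> R^o).
Proof.
apply: moment_linearl => [|m]; last first.
  exact: (cell_monomial a b [ffun=> false] m).1.
by apply: measurableX; [apply: measurableX|]; exact: mI.
Qed.

End Forms.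

Theorem proposition3p5 (R : realType) (k : nat) (hk : (3 <= k)%N)
  (a b : 'I_3 -> R) (hab : forall m : 'I_3, a m < b m)
  (E : forall i : 'I_3, {ffun 'I_3 -> bool} -> seq (Qpoly R (edge_deg k i)))
  (F : forall i j : 'I_3, {ffun 'I_3 -> bool} ->
         seq (Qpoly R (face_deg k i j)))
  (C : forall i : 'I_3, seq (Qpoly R (cell_deg k i)))
  (hE : forall (i : 'I_3) (v : {ffun 'I_3 -> bool}),
          v \in edges i -> basis_of fullv (E i v))
  (hF : forall (i j : 'I_3) (v : {ffun 'I_3 -> bool}),
          j != i -> v \in faces i j -> basis_of fullv (F i j v))
  (hC : forall i : 'I_3, basis_of fullv (C i)) :
  unisolvent (flatten [seq edge_dofs a b E i ++ face_dofs a b F i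
                             ++ cell_dofs a b C i | i <- enum 'I_3]).
Proof.
case: k hk E F C hE hF hC => [|[|[|K]]]// _ E F C hE hF hC.
pose form := @component_form R K.+3.
(* The three families are rebuilt as linear forms, in the order of the given functionals. *)
pose XE i := [seq form (edge_moment a b i v p) i |
  v : {ffun 'I_3 -> bool} <- edges i, p : Qpoly R (edge_deg K.+3 i) <- E i v].
pose XF i := flatten [seq [seq form (face_moment a b i j v p) i
                          | v : {ffun 'I_3 -> bool} <- faces i j,
                            p : Qpoly R (face_deg K.+3 i j) <- F i j v]
                     | j <- enum 'I_3 & j != i].
pose XC i := [seq form (cell_moment a b p) i | p : Qpoly R _ <- C i].
exists (flatten [seq XE i ++ XF i ++ XC i | i <- enum 'I_3]); split.
  rewrite map_flatten -map_comp; congr flatten; apply: eq_map => i /=.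
  rewrite !map_cat; congr (_ ++ (_ ++ _)).
  - rewrite /XE map_allpairs /edge_dofs; congr allpairs_dep.
    apply/funext => v; apply/funext => p; apply: component_formE.
    exact: edge_moment_linear.
  - rewrite /XF map_flatten -map_comp /face_dofs; congr flatten.
    apply/eq_in_map => j; rewrite mem_filter => /andP[ji _] /=.
    rewrite map_allpairs; congr allpairs_dep.
    apply/funext => v; apply/funext => p; apply: component_formE.
    exact: face_moment_linear.
  - rewrite /XC -map_comp; apply: eq_map => p /=; apply: component_formE.
    exact: cell_moment_linear.
apply: basis_of_dual.
  rewrite dim_shape_space size_flatten /shape -map_comp sumnE big_map big_enum.
  apply: eq_bigr => i _ /=; rewrite !size_cat size_map.
  rewrite /XE (size_allpairs_cst _ (n := K.+2)); last first.
    move=> v vi; rewrite (size_basis_Qpoly (hE i v vi)).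
    by move: i {vi}; apply: forall_ord3;
       rewrite /edge_deg /= !subSS subn0 ?muln1 ?mul1n.
  rewrite (size_basis_Qpoly (hC i)) size_edges size_Qmonomials.
  (* Two axes [j], two faces for each, and (k-1)(k-2) moments per face. *)
  have -> : size (XF i) = (2 * (2 * (K.+2 * K.+1)))%N.
    rewrite size_flatten /shape -map_comp sumnE big_map big_filter.
    rewrite big_enum_cond/=.
    rewrite (eq_bigr (fun=> 2 * (K.+2 * K.+1)))%N => [|j ji].
      rewrite sum_nat_const; congr (_ * _)%N.
      by rewrite (eq_card (B := predC1 i))// cardC1 card_ord.
    rewrite (size_allpairs_cst _ (n := K.+2 * K.+1))%N ?size_faces//.
    move=> v vij; rewrite (size_basis_Qpoly (hF i j v ji vij)).
    by move: i j ji {vij}; do 2 (apply: forall_ord3 => //); move=> _;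
       rewrite /face_deg /= !subSS !subn0 ?muln1 ?mul1n// mulnC.
  (* With k = K + 3 this is 4(k-1) + 4(k-1)(k-2) + (k-1)(k-2)^2 = (k-1)k^2. *)
  by move: i; apply: forall_ord3;
     rewrite /cell_deg /shape_deg /= !subSS !subn0; ring.
move=> q Xq.
(* Each component is annihilated by its own block of forms. *)
have comp0 i : component q i = 0.
  have iX phi : phi \in XE i ++ XF i ++ XC i -> phi q = 0.
    move=> phiX; apply: Xq; apply/flattenP.
    exists (XE i ++ XF i ++ XC i) => //.
    by apply/mapP; exists i; rewrite ?mem_enum.
  have formE L : linear (L : mpoly 3 R -> R^o) ->
      form L i q = L (component q i).
    move=> LL.
    by have := congr1 (fun g => g q) (@component_formE R K.+3 L i LL).
  apply: (component_eq0 (E := E i) (F := F i) (C := C i) hab) => //.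
  - exact: component_Qpred.
  - exact: hE.
  - exact: hF.
  - move=> v p vi pE; rewrite -[LHS](formE _ (edge_moment_linear a b i v p)).
    apply: iX; rewrite mem_cat; apply/orP; left.
    exact: (allpairs_f_dep (fun v p => form _ _) vi pE).
  - move=> j v p ji vij pF.
    rewrite -[LHS](formE _ (face_moment_linear a b v p ji)).
    apply: iX; rewrite !mem_cat; apply/orP; right; apply/orP; left.
    apply/flattenP; exists [seq form (face_moment a b i j v p) i |
        v : {ffun 'I_3 -> bool} <- faces i j,
        p : Qpoly R (face_deg K.+3 i j) <- F i j v].
      apply: (map_f (fun j => allpairs_dep _ _ _)).
      by rewrite mem_filter ji mem_enum.
    exact: (allpairs_f_dep (fun v p => form _ _) vij pF).
  - move=> p pC; rewrite -[LHS](formE _ (cell_moment_linear a b p)).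
    apply: iX; rewrite !mem_cat; apply/orP; right; apply/orP; right.
    exact: map_f.
move: q comp0 {Xq} => [[qx qy] qz] comp0.
congr (_, _, _); apply: val_inj.
- exact: (comp0 ox).
- exact: (comp0 oy).
- exact: (comp0 oz).
Qed.
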